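(* Let $(X,\mu,T)$ be a conservative ergodic nonsingular dynamical system. If it is Li-Yorke M-sensitive, then it is W-measurably sensitive.
   Context: A nonsingular dynamical system $(X,\mu,T)$ consists of a standard Borel space $X$ with a $\sigma$-finite nonatomic (nonzero) measure $\mu$ and a measurable map $T:X\to X$ such that $\mu(A)=0$ iff $\mu(T^{-1}A)=0$ for measurable $A$. $T$ is conservative if for every $A$ with $\mu(A)>0$ there is $n>0$ with $\mu(T^{-n}A\cap A)>0$, and ergodic if $T^{-1}(A)=A$ implies $\mu(A)=0$ or $\mu(X\setminus A)=0$. All metrics on $X$ are assumed Borel measurable on $X\times X$ and bounded by $1$. A metric $d$ is $\mu$-compatible if every nonempty open $d$-ball has positive $\mu$-measure. A pair $(x,y)$ is a Li-Yorke pair for $d$ if $\liminf_{n\to\infty}d(T^nx,T^ny)=0$ and $\limsup_{n\to\infty}d(T^nx,T^ny)>0$. The system is Li-Yorke M-sensitive if for every $\mu$-compatible metric $d$ the set of Li-Yorke pairs for $d$ has full $\mu\times\mu$-measure. It is W-measurably sensitive with respect to $d$ if there is $\delta>0$ such that for each $x\in X$, $\limsup_{n\to\infty}d(T^nx,T^ny)>\delta$ for a.e. $y\in X$; it is W-measurably sensitive if this holds for every $\mu$-compatible metric $d$. *)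

(* Defs.v *)
From mathcomp Require Import all_boot all_order all_algebra.
From mathcomp Require Import all_classical all_reals all_analysis.

Set Implicit Arguments.
Unset Strict Implicit.
Unset Printing Implicit Defensive.

Import Order.TTheory GRing.Theory Num.Theory.
Import numFieldNormedType.Exports.

Local Open Scope classical_set_scope.
Local Open Scope ring_scope.

(* Metrics are plain functions, not [metricType] structures: the statement
   quantifies over many metrics on one and the same measurable space. *)
Record is_metric (R : realType) (X : Type) (d : X -> X -> R) : Prop := IsMetric {
  metric_ge0 : forall x y, 0 <= d x y ;
  metric_eq0 : forall x y, d x y = 0 <-> x = y ;
  metric_sym : forall x y, d x y = d y x ;
  metric_triangle : forall x y z, d x z <= d x y + d y z }.

Definition metric_ball (R : realType) (X : Type) (d : X -> X -> R)
  (x : X) (r : R) : set X := [set y | d x y < r].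

Definition metric_open (R : realType) (X : Type) (d : X -> X -> R) : set (set X) :=
  [set U | forall x, U x -> exists2 r, 0 < r & metric_ball d x r `<=` U].

Definition metric_complete (R : realType) (X : Type) (d : X -> X -> R) : Prop :=
  forall u : nat -> X,
    (forall e, 0 < e ->
       exists N, forall m n, (N <= m)%N -> (N <= n)%N -> d (u m) (u n) < e) ->
    exists l, (fun n => d (u n) l) @ \oo --> 0.

Definition metric_separable (R : realType) (X : Type) (d : X -> X -> R) : Prop :=
  exists D : set X, countable D /\
    forall x r, 0 < r -> exists2 y, D y & metric_ball d x r y.

Definition standard_borel (R : realType) (disp : measure_display)
    (X : measurableType disp) : Prop :=
  exists d : X -> X -> R,
    [/\ is_metric d, metric_complete d, metric_separable d &
        (measurable : set (set X)) = <<s metric_open d >>].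

Section systems.
Context (R : realType) (disp : measure_display) (X : measurableType disp).

Definition nonatomic (mu : set X -> \bar R) : Prop :=
  forall A, measurable A -> (0 < mu A)%E ->
    exists B, [/\ measurable B, B `<=` A, (0 < mu B)%E & (mu B < mu A)%E].

Record nonsingular_system (mu : {sigma_finite_measure set X -> \bar R})
    (T : X -> X) : Prop := NonsingularSystem {
  system_standard : standard_borel R X ;
  system_nonatomic : nonatomic mu ;
  system_nonzero : mu setT <> 0%E ;
  system_measurable : measurable_fun setT T ;
  system_nonsingular : forall A, measurable A ->
    mu A = 0%E <-> mu (T @^-1` A) = 0%E }.

Definition conservative (mu : set X -> \bar R) (T : X -> X) : Prop :=
  forall A, measurable A -> (0 < mu A)%E ->
    exists2 n : nat, (0 < n)%N & (0 < mu ((iter n T @^-1` A) `&` A))%E.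

Definition ergodic (mu : set X -> \bar R) (T : X -> X) : Prop :=
  forall A, measurable A -> T @^-1` A = A -> mu A = 0%E \/ mu (~` A) = 0%E.

(* The library's product sigma-algebra on [X * X] is the Borel sigma-algebra
   of the square, since [X] is standard Borel in the intended use. *)
Record borel_metric (d : X -> X -> R) : Prop := BorelMetric {
  borel_metric_metric : is_metric d ;
  borel_metric_measurable : measurable_fun setT (fun p : X * X => d p.1 p.2) ;
  borel_metric_le1 : forall x y, d x y <= 1 }.

Definition compatible (mu : set X -> \bar R) (d : X -> X -> R) : Prop :=
  borel_metric d /\ forall x r, 0 < r -> (0 < mu (metric_ball d x r))%E.

Definition orbit_dist (d : X -> X -> R) (T : X -> X) (x y : X) : nat -> \bar R :=
  fun n => (d (iter n T x) (iter n T y))%:E.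

Definition li_yorke_pair (d : X -> X -> R) (T : X -> X) (x y : X) : Prop :=
  limn_einf (orbit_dist d T x y) = 0%E /\ (0 < limn_esup (orbit_dist d T x y))%E.

Definition li_yorke_M_sensitive (mu : {sigma_finite_measure set X -> \bar R})
    (T : X -> X) : Prop :=
  forall d, compatible mu d ->
    {ae (mu \x mu)%E, forall p : X * X, li_yorke_pair d T p.1 p.2}.

Definition W_measurably_sensitive_wrt
    (mu : {sigma_finite_measure set X -> \bar R}) (T : X -> X)
    (d : X -> X -> R) : Prop :=
  exists2 delta : R, 0 < delta &
    forall x, {ae mu, forall y, (delta%:E < limn_esup (orbit_dist d T x y))%E}.

Definition W_measurably_sensitive
    (mu : {sigma_finite_measure set X -> \bar R}) (T : X -> X) : Prop :=
  forall d, compatible mu d -> W_measurably_sensitive_wrt mu T d.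

End systems.

(* Main.v *)
(* If the system is not W-measurably sensitive for a compatible metric d, let
   D (x, y) = limsup d (T^n x, T^n y), a T-invariant pseudometric. For every
   delta > 0 some D-ball B of radius delta has positive measure, and by
   conservativity and ergodicity almost every orbit visits B. Hence, with f the
   time of the first visit to B, D (x, y) > 2 delta forces f x <> f y, and by
   invariance f (T^n x) <> f (T^n y) for all n. Li-Yorke sensitivity for d lets
   one choose delta so that D > 2 delta on a non-null set of pairs.

   It then suffices to find a compatible metric d' with d' (x, y) = 1 whenever
   f x <> f y, for x and y off a null set: no pair above is Li-Yorke for d'.
   Take for d' the distance between sequences of countable-valued codes that
   separate points and start with f. Its balls contain cylinders, and the points
   whose cylinders are null form a null set Z. Nonatomicity provides a countable
   family of disjoint positive sets, indexed by finite binary words, inside one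
   fibre of f; recoding these sets makes them accumulate at the points of Z. *)
Require Import Defs.
From mathcomp Require Import all_boot all_order all_algebra.
From mathcomp Require Import all_classical all_reals all_analysis.
From mathcomp Require Import lra measurable_realfun.

Local Open Scope classical_set_scope.
Local Open Scope ring_scope.

Set Implicit Arguments.
Unset Strict Implicit.
Unset Printing Implicit Defensive.

Import Order.TTheory GRing.Theory Num.Theory.
Import numFieldNormedType.Exports.

(** * Limits superior of extended real sequences *)

Section limsup.
Context (R : realType).
Local Open Scope ereal_scope.
Implicit Types (u v w : nat -> \bar R) (a b : \bar R).

Lemma limn_esup_inf u : limn_esup u = ereal_inf (range (esups u)).
Proof. by rewrite limn_esup_lim; apply/cvg_lim => //; exact: cvg_esups_inf. Qed.

Lemma limn_esup_le u a N :
  (forall n, (N <= n)%N -> u n <= a) -> limn_esup u <= a.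
Proof.
move=> ua; rewrite limn_esup_inf; apply: (@le_trans _ _ (esups u N)).
  by apply: ereal_inf_lbound; exists N.
by apply: ge_ereal_sup => _ [n /= Nn <-]; exact: ua.
Qed.

Lemma limn_esup_lt u a : limn_esup u < a ->
  exists N, forall n, (N <= n)%N -> u n < a.
Proof.
rewrite limn_esup_inf => /ereal_inf_lt[_ [N _ <-] uNa].
exists N => n Nn; apply: le_lt_trans uNa.
by apply: ereal_sup_ubound; exists n.
Qed.

Lemma limn_esup_shift u : limn_esup (fun n => u n.+1) = limn_esup u.
Proof.
rewrite !limn_esup_inf; apply/eqP; rewrite eq_le; apply/andP; split.
  apply: le_ereal_inf_tmp => _ [n _ <-].
  apply: (@le_trans _ _ (esups (fun n => u n.+1) n)).
    by apply: ereal_inf_lbound; exists n.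
  apply: ge_ereal_sup => _ [m /= nm <-].
  by apply: ereal_sup_ubound; exists m.+1 => //=; exact: leqW.
apply: le_ereal_inf_tmp => _ [n _ <-].
apply: (@le_trans _ _ (esups u n.+1)); first by apply: ereal_inf_lbound; exists n.+1.
apply: ge_ereal_sup => _ [[//|m] /= nm <-].
by apply: ereal_sup_ubound; exists m.
Qed.

(** Real bounds [a] and [b] stand in for the limits superior, so that no sum of opposite infinities
    arises. *)
Lemma limn_esup_add u v w (a b : R) : (forall n, w n <= u n + v n) ->
  limn_esup u <= a%:E -> limn_esup v <= b%:E -> limn_esup w <= (a + b)%:E.
Proof.
move=> wuv ua vb; apply/lee_addgt0Pr => e e0.
have e20 : (0 < e / 2)%R by rewrite divr_gt0.
have [N uN] : exists N, forall n, (N <= n)%N -> u n < (a + e / 2)%:E.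
  by apply: limn_esup_lt; apply: le_lt_trans ua _; rewrite lte_fin ltrDl.
have [M vM] : exists N, forall n, (N <= n)%N -> v n < (b + e / 2)%:E.
  by apply: limn_esup_lt; apply: le_lt_trans vb _; rewrite lte_fin ltrDl.
apply: (@limn_esup_le _ _ (maxn N M)) => n; rewrite geq_max => /andP[Nn Mn].
apply: le_trans (wuv n) _.
have -> : (a + b)%:E + e%:E = (a + e / 2)%:E + (b + e / 2)%:E.
  by rewrite -!EFinD; congr EFin; lra.
by apply: leeD; apply/ltW; [exact: uN|exact: vM].
Qed.

Lemma le_limn_einf u a : (forall n, a <= u n) -> a <= limn_einf u.
Proof.
move=> au; rewrite /limn_einf leeNr; apply: (@limn_esup_le _ _ 0) => n _.
by rewrite leeN2.
Qed.

End limsup.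

(** * Countable-valued measurable maps *)

Section labels.
Context (disp : measure_display) (X : measurableType disp).

(** Measurability for the discrete sigma-algebra on [K], stated without giving [K] a measurable
    structure. *)
Definition label_measurable (K : Type) (h : X -> K) :=
  forall A : set K, measurable (h @^-1` A).

Lemma label_measurableP (K : countType) (h : X -> K) :
  (forall k, measurable (h @^-1` [set k])) -> label_measurable h.
Proof.
move=> mh A.
have -> : h @^-1` A = \bigcup_(k : K) (h @^-1` [set k] `&` [set _ | A k]).
  apply/seteqP; split => [x Ahx|x [k _ [/= -> //]]].
  by exists (h x).
apply: countable_bigcupT_measurable => // k.
apply: measurableI => //; case: (pselect (A k)) => Ak.
  by rewrite (_ : [set _ | _] = setT)//; apply/seteqP; split.
by rewrite (_ : [set _ | _] = set0)//; apply/seteqP; split.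
Qed.

Lemma label_measurable_comp (K L : Type) (h : X -> K) (F : K -> L) :
  label_measurable h -> label_measurable (F \o h).
Proof. by move=> mh A; exact: (mh (F @^-1` A)). Qed.

Lemma label_measurable_pair (K L : countType) (h : X -> K) (k : X -> L) :
  label_measurable h -> label_measurable k ->
  label_measurable (fun x => (h x, k x)).
Proof.
move=> mh mk; apply: label_measurableP => -[a b].
have -> : (fun x => (h x, k x)) @^-1` [set (a, b)] =
    h @^-1` [set a] `&` k @^-1` [set b].
  by apply/seteqP; split => x /= [-> ->].
exact: measurableI.
Qed.

Lemma label_measurable_mkseq (K : countType) (c : nat -> X -> K) n :
  (forall i, label_measurable (c i)) ->
  label_measurable (fun x => mkseq (c ^~ x) n).
Proof.
move=> mc; elim: n => [A|n IHn].
  by rewrite preimage_cst; case: ifP.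
have -> : (fun x => mkseq (c ^~ x) n.+1) =
    (fun p => rcons p.1 p.2) \o (fun x => (mkseq (c ^~ x) n, c n x)).
  by apply/funext => x /=; rewrite mkseqS.
by apply: label_measurable_comp; exact: label_measurable_pair.
Qed.

Lemma measurable_label_eq (K : countType) (h : X -> K) :
  label_measurable h -> measurable [set p : X * X | h p.1 = h p.2].
Proof.
move=> mh.
have -> : [set p : X * X | h p.1 = h p.2] =
    \bigcup_(k : K) (h @^-1` [set k] `*` h @^-1` [set k]).
  apply/seteqP; split => [p /= hp|p [k _ [/= -> ->//]]].
  by exists (h p.1).
by apply: countable_bigcupT_measurable => // k; exact: measurableX.
Qed.

(** Packs a disjoint family into a single map; [None] marks the points outside its union. *)
Lemma label_of_disjoint (K : countType) (Q : K -> set X) :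
  (forall k, measurable (Q k)) ->
  (forall x k l, Q k x -> Q l x -> k = l) ->
  exists2 q : X -> option K, label_measurable q &
    forall x k, q x = Some k <-> Q k x.
Proof.
move=> mQ Qinj; pose q x := xget None [set Some k | k in [set k : K | Q k x]].
have qE x k : q x = Some k <-> Q k x.
  split => [|Qkx].
    by rewrite /q; case: xgetP => [_ -> [l /= Qlx <-] [<-//]|].
  have : [set Some k | k in [set k : K | Q k x]] (q x).
    by apply: xgetPex; exists (Some k), k.
  by move=> [l /= Qlx <-]; congr Some; exact: Qinj Qlx Qkx.
exists q => //; apply: label_measurableP => -[k|].
  rewrite (_ : q @^-1` _ = Q k)//.
  by apply/seteqP; split => x /qE.
rewrite (_ : q @^-1` _ = ~` \bigcup_k Q k).
  by apply: measurableC; exact: countable_bigcupT_measurable.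
apply/seteqP; split => x /=.
  by move=> qN [k _ /qE]; rewrite qN.
move=> nQ; case qx : (q x) => [k|//]; case: nQ; exists k => //; exact/qE.
Qed.

(** * Null and positive sets *)

Context (R : realType) (mu : {measure set X -> \bar R}).

Lemma null_bigcup_countable (K : countType) (F : K -> set X) :
  (forall k, measurable (F k) /\ mu (F k) = 0%E) ->
  measurable (\bigcup_k F k) /\ mu (\bigcup_k F k) = 0%E.
Proof.
move=> F0; have mF : measurable (\bigcup_k F k).
  by apply: countable_bigcupT_measurable => // k; case: (F0 k).
split=> //; apply: measure_negligible => //.
pose G n := if unpickle n is Some k then F k else set0.
apply: (@negligibleS _ _ _ mu (\bigcup_n G n)).
  by move=> x [k _ Fkx]; exists (pickle k) => //; rewrite /G pickleK.
apply: negligible_bigcup => n; rewrite /G; case: (unpickle n) => [k|].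
  by have [mFk Fk0] := F0 k; apply/negligibleP.
exact: negligible_set0.
Qed.

(** There are only countably many fibres, so the null ones have a null union. *)
Lemma null_cells (K : countType) (h : X -> K) : label_measurable h ->
  measurable [set x | mu (h @^-1` [set h x]) = 0%E] /\
  mu [set x | mu (h @^-1` [set h x]) = 0%E] = 0%E.
Proof.
move=> mh; pose F k := if pselect (mu (h @^-1` [set k]) = 0%E)
  then h @^-1` [set k] else set0.
have -> : [set x | mu (h @^-1` [set h x]) = 0%E] = \bigcup_k F k.
  apply/seteqP; split => [x /= hx0|x [k _]].
    by exists (h x) => //; rewrite /F; case: pselect.
  by rewrite /F; case: pselect => // k0 /= ->.
apply: null_bigcup_countable => k; rewrite /F; case: pselect => //= _.
Qed.

Lemma exists_pos_label (K : countType) (h : X -> K) : label_measurable h ->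
  mu setT <> 0%E -> exists k, (0 < mu (h @^-1` [set k]))%E.
Proof.
move=> mh T0; apply: contrapT => nk; apply: T0.
have -> : setT = \bigcup_k (h @^-1` [set k]).
  by apply/seteqP; split => // x _; exists (h x).
apply: (null_bigcup_countable _).2 => k; split => //.
apply/eqP; rewrite -[_ == _]negbK -measure_gt0; apply/negP => k0.
by apply: nk; exists k.
Qed.

Lemma null_subset (A B : set X) : measurable A -> measurable B ->
  A `<=` B -> mu B = 0%E -> mu A = 0%E.
Proof.
by move=> mA mB AB B0; apply/eqP; rewrite -measure_le0 -B0 le_measure ?inE.
Qed.

Lemma pos_subset (A B : set X) : measurable A -> measurable B ->
  A `<=` B -> (0 < mu A)%E -> (0 < mu B)%E.
Proof. by move=> mA mB AB A0; apply: lt_le_trans A0 _; rewrite le_measure ?inE. Qed.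

Lemma measureD_null (A Z : set X) : measurable A -> measurable Z ->
  mu Z = 0%E -> mu (A `\` Z) = mu A.
Proof.
move=> mA mZ Z0; have -> : mu A = (mu (A `\` Z) + mu (A `&` Z))%E by exact: measureDI.
rewrite (_ : mu (A `&` Z) = 0%E) ?adde0//.
by apply: (null_subset _ mZ _ Z0) => //; exact: measurableI.
Qed.

(** Iterating nonatomicity gives nested positive sets of strictly decreasing measure. Their
    successive differences are disjoint, and positive because a null difference would give two
    consecutive sets the same measure; [pickle] indexes them by [K]. *)
Lemma pos_label_of_nonatomic (K : countType) (A : set X) :
  nonatomic mu -> measurable A -> (0 < mu A)%E ->
  exists q : X -> option K,
    [/\ label_measurable q, forall x, q x != None -> A x &
        forall k, (0 < mu (q @^-1` [set Some k]))%E].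
Proof.
move=> na mA A0.
pose good := {B : set X | measurable B /\ (0 < mu B)%E}.
have next (B : good) : exists C : good,
    sval C `<=` sval B /\ (mu (sval C) < mu (sval B))%E.
  case: B => B [mB B0] /=; have [C [mC CB C0 CltB]] := na _ mB B0.
  by exists (exist _ C (conj mC C0)).
have [f fP] := choice next.
pose B n := sval (iter n f (exist _ A (conj mA A0))).
have mB n : measurable (B n) by rewrite /B; case: (iter _ _ _) => ? [].
have BS n : B n.+1 `<=` B n by have [] := fP (iter n f (exist _ A (conj mA A0))).
have Blt n : (mu (B n.+1) < mu (B n))%E.
  by have [] := fP (iter n f (exist _ A (conj mA A0))).
have Ble m n : (m <= n)%N -> B n `<=` B m.
  move=> /subnK <-; elim: (n - m)%N => [//|k IHk]; rewrite addSn.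
  exact: subset_trans (BS _) IHk.
pose Q n := B n `\` B n.+1.
have mQ n : measurable (Q n) by exact: measurableD.
have Qinj x m n : Q m x -> Q n x -> m = n.
  have aux i j : (i < j)%N -> Q i x -> Q j x -> False.
    by move=> ij [_ nB] [Bj _]; apply: nB; exact: Ble Bj.
  move=> Qm Qn; case: (ltngtP m n) => // [mn|nm].
    by case: (aux _ _ mn).
  by case: (aux _ _ nm).
have Qpos n : (0 < mu (Q n))%E.
  rewrite measure_gt0; apply/eqP => Q0; have := Blt n.
  have -> : mu (B n) = (mu (Q n) + mu (B n `&` B n.+1))%E by exact: measureDI.
  rewrite Q0 add0e.
  by rewrite (_ : _ `&` _ = B n.+1) ?ltxx//; apply/setIidr; exact: BS.
have QKinj x (k l : K) : Q (pickle k) x -> Q (pickle l) x -> k = l.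
  by move=> Qk Ql; apply/(pcan_inj pickleK); exact: Qinj Qk Ql.
have [q mq qE] := label_of_disjoint (fun k : K => mQ (pickle k)) QKinj.
exists q; split => // [x|k].
  case qx : (q x) => [k|//] _.
  by move/qE : qx => [Bk _]; exact: (Ble 0%N _ _ _ Bk).
rewrite (_ : q @^-1` _ = Q (pickle k))//.
by apply/seteqP; split => x /qE.
Qed.

End labels.

(** * Metrics from sequences of codes *)

Section code_metric.
Context (R : realType) (disp : measure_display) (X : measurableType disp).
Context (K : countType) (g : nat -> X -> K).
Hypothesis mg : forall i, label_measurable (g i).
Hypothesis g_inj : forall x y, (forall i, g i x = g i y) -> x = y.

Definition code_term (x y : X) (i : nat) : R :=
  if g i x == g i y then 0 else 2^-1 ^+ i.

(** This is [2^-1 ^+ i] for the first index [i] where the codes differ, the usual metric on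
    sequences; writing it as a supremum makes measurability immediate. *)
Definition code_dist (x y : X) : R := sups (code_term x y) 0.

Lemma code_term_ge0 x y i : 0 <= code_term x y i.
Proof. by rewrite /code_term; case: ifP => // _; rewrite exprn_ge0. Qed.

Lemma code_term_le1 x y i : code_term x y i <= 1.
Proof.
rewrite /code_term; case: ifP => // _.
by rewrite exprn_ile1// invf_le1// ler1n.
Qed.

Lemma code_term_ubound x y : has_ubound (range (code_term x y)).
Proof. by exists 1 => _ [i _ <-]; exact: code_term_le1. Qed.

Lemma code_term_le x y i : code_term x y i <= code_dist x y.
Proof.
apply: ub_le_sup; last by exists i.
by exists 1 => _ [k _ <-]; exact: code_term_le1.
Qed.

Lemma code_dist_le x y a :
  (forall i, code_term x y i <= a) -> code_dist x y <= a.
Proof.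
move=> xya; apply: ge_sup; first by exists (code_term x y 0%N), 0%N.
by move=> _ [i _ <-].
Qed.

Lemma code_dist_eq1 x y : g 0%N x != g 0%N y -> code_dist x y = 1.
Proof.
move=> gxy; apply/eqP; rewrite eq_le code_dist_le ?andTb; last first.
  by move=> i; exact: code_term_le1.
by apply: le_trans (code_term_le x y 0%N); rewrite /code_term (negbTE gxy).
Qed.

Lemma code_dist_metric : is_metric code_dist.
Proof.
split.
- by move=> x y; apply: le_trans (code_term_le x y 0%N); exact: code_term_ge0.
- move=> x y; split => [xy0|->]; last first.
    apply/eqP; rewrite eq_le (le_trans _ (code_term_le y y 0%N)) ?code_term_ge0//.
    by rewrite andbT; apply: code_dist_le => i; rewrite /code_term eqxx.
  apply: g_inj => i; apply/eqP; move: (code_term_le x y i).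
  rewrite xy0 /code_term; case: ifP => // _; rewrite leNgt.
  by rewrite exprn_gt0// invr_gt0.
- move=> x y; rewrite /code_dist; congr (sups _ 0); apply/funext => i.
  by rewrite /code_term eq_sym.
(* The inequality holds term by term: if the codes of [x] and [z] differ, they cannot both equal
   that of [y]. *)
- move=> x y z; apply: code_dist_le => i.
  apply: le_trans (lerD (code_term_le x y i) (code_term_le y z i)).
  rewrite /code_term; have [<-|_] := eqVneq (g i x) (g i y).
    by rewrite add0r.
  by case: eqP; case: eqP => *; rewrite ?addr0 ?addr_ge0 ?exprn_ge0// lerDl exprn_ge0.
Qed.

Lemma code_dist_borel : borel_metric code_dist.
Proof.
split; [exact: code_dist_metric| |].
  apply: (@measurable_fun_sups _ _ R setT (fun i p => code_term p.1 p.2 i)).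
    by move=> p _; exact: code_term_ubound.
  move=> i; rewrite /code_term; apply: measurable_fun_ifT => //.
  apply: (measurable_fun_bool true).
  rewrite setTI (_ : _ @^-1` _ = [set p : X * X | g i p.1 = g i p.2]).
    exact: measurable_label_eq.
  by apply/seteqP; split => p /= /eqP.
by move=> x y; apply: code_dist_le => i; exact: code_term_le1.
Qed.

(** Agreement below index [m] bounds the distance by [2^-1 ^+ m]. *)
Lemma code_ball_sub x r : 0 < r -> exists m,
  [set y | forall i, (i < m)%N -> g i y = g i x] `<=` metric_ball code_dist x r.
Proof.
move=> r0; have : (fun m => 2^-1 ^+ m : R) @ \oo --> 0.
  by apply: cvg_expr; rewrite gtr0_norm ?invr_gt0// invf_lt1// ltr1n.
move=> /cvgr0_norm_lt /(_ _ r0)[m _ mr]; exists m => y /= xy.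
apply: le_lt_trans (mr m (leqnn m)).
rewrite ger0_norm ?exprn_ge0//; apply: code_dist_le => i.
rewrite /code_term; case: ifPn => [_|gi]; first by rewrite exprn_ge0.
have mi : (m <= i)%N by rewrite leqNgt; apply: contra gi => /xy ->.
by rewrite ler_wiXn2l// ?invf_le1// ler1n.
Qed.

(** Every ball contains a cylinder, so a positive set inside each cylinder is enough. *)
Lemma code_dist_compatible (mu : {measure set X -> \bar R}) :
  (forall x m, exists A, [/\ measurable A, (0 < mu A)%E &
     forall y, A y -> forall i, (i < m)%N -> g i y = g i x]) ->
  compatible mu code_dist.
Proof.
move=> pos; split; first exact: code_dist_borel.
move=> x r r0; have [m sub] := code_ball_sub x r0.
have [A [mA A0 Ag]] := pos x m.
apply: (pos_subset mA _ _ A0); last first.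
  by move=> y /Ag Ay; exact: sub.
have [_ md _] := code_dist_borel.
have := measurable_fun_pair2 x md measurableT (measurable_itv `]-oo, r[).
rewrite setTI (_ : _ @^-1` _ = metric_ball code_dist x r)//.
Qed.

End code_metric.

(** * Countable separation of points *)

Section separating_sets.
Context (R : realType) (disp : measure_display) (X : measurableType disp).

(** The bits of a point record which balls of radius [1/(n+1)] about the points of a countable dense
    set contain it. *)
Lemma standard_borel_separating : standard_borel R X ->
  exists c : nat -> X -> bool, (forall i, label_measurable (c i)) /\
    forall x y, (forall i, c i x = c i y) -> x = y.
Proof.
move=> [d [dm _ [D [/countable_injP[f finj] dense]] mE]].
(* The centre is named by its number under [f]; [U p] is empty if no point of [D] has number
   [p.1]. *)
pose U (p : nat * nat) : set X := [set x | exists2 a, D a &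
  f a = p.1 /\ d a x < p.2.+1%:R^-1].
have mU p : measurable (U p).
  rewrite mE; apply: sub_sigma_algebra => x [a Da [fa ax]].
  exists (p.2.+1%:R^-1 - d a x); first by rewrite subr_gt0.
  move=> y; rewrite /metric_ball/= => xy; exists a => //; split => //.
  apply: (le_lt_trans (Defs.metric_triangle dm a x y)).
  by rewrite -ltrBrDl.
pose c i x := if unpickle i is Some p then `[< U p x >] else false.
exists c; split.
  move=> i; apply: label_measurableP => b; rewrite /c.
  case: (unpickle i) => [p|]; last by rewrite preimage_cst; case: ifP.
  case: b.
    rewrite (_ : _ @^-1` _ = U p)//.
    by apply/seteqP; split => x /= /asboolP.
  rewrite (_ : _ @^-1` _ = ~` U p); first exact: measurableC.
  by apply/seteqP; split => x /= => [/negbT/asboolPn//|nU]; apply/negbTE/asboolPn.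
move=> x y cxy; apply/(Defs.metric_eq0 dm); apply/eqP; apply: contrapT => /negP xy.
have {xy} xy : 0 < d x y by rewrite lt_neqAle eq_sym xy (Defs.metric_ge0 dm).
have [n nxy] : exists n, n.+1%:R^-1 < d x y / 2.
  have /cvgr0_norm_lt/(_ (d x y / 2)) : (fun n => n.+1%:R^-1 : R) @ \oo --> 0.
    exact: cvg_harmonic.
  rewrite divr_gt0// => /(_ isT)[n _ /(_ n (leqnn n))].
  by rewrite ger0_norm// => ?; exists n.
have n0 : 0 < n.+1%:R^-1 :> R by rewrite invr_gt0.
(* As [2/(n+1)] is below [d x y], the ball of radius [1/(n+1)] about [a] contains [x] but not
   [y]. *)
have [a Da xa] := dense x _ n0.
have := cxy (pickle (f a, n)); rewrite /c pickleK.
have /asboolP -> : U (f a, n) x by exists a => //; rewrite (Defs.metric_sym dm).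
move=> /esym/asboolP[b Db [/= fab b_y]].
have ab : b = a by apply: finj => //; rewrite inE.
have tri := Defs.metric_triangle dm x a y.
by move: b_y xa nxy; rewrite ab /metric_ball/=; move: (_^-1) => e; lra.
Qed.

End separating_sets.

(** * A compatible metric separating the fibres of a label *)

Section separating_metric.
Context (R : realType) (disp : measure_display) (X : measurableType disp).
Context (mu : {measure set X -> \bar R}).

(** Refining [f] by separating bits gives a metric at once, but balls around points with null
    cylinders may be null. Those points are recoded so that positive sets share arbitrarily long
    initial parts of their codes. *)
Lemma exists_separating_metric (f : X -> nat) :
  standard_borel R X -> nonatomic mu -> mu setT <> 0%E ->
  label_measurable f ->
  exists (d : X -> X -> R) (Z : set X), [/\ compatible mu d,
    measurable Z, mu Z = 0%E &
    forall x y, ~ Z x -> ~ Z y -> f x <> f y -> d x y = 1].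
Proof.
move=> sb na T0 mf.
have [c [mc c_inj]] := standard_borel_separating sb.
have [k0 k0_pos] := exists_pos_label mf T0.
(* Each finite word [s] owns the positive set [q = Some s], inside the fibre of [f] over [k0]. *)
have [q [mq qf qpos]] := @pos_label_of_nonatomic _ _ _ mu (seq bool) _ na (mf _) k0_pos.
pose key m x := mkseq (c ^~ x) m.
have mkey m : label_measurable (key m) by exact: label_measurable_mkseq.
(* The tag [0] is reserved for the word sets. These lie in a single fibre of [f], so points with
   different values of [f] still get different tags. *)
pose lab x : nat * seq bool :=
  if q x is Some s then (0%N, s) else ((f x).+1, [::]).
have mlab : label_measurable lab.
  have -> : lab = (fun p : option (seq bool) * nat =>
      if p.1 is Some s then (0%N, s) else (p.2.+1, [::])) \o (fun x => (q x, f x)).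
    by [].
  by apply: label_measurable_comp; exact: label_measurable_pair.
pose cell m x := (lab x, key m x).
have mcell m : label_measurable (cell m) by exact: label_measurable_pair.
pose Z := \bigcup_m [set x | mu (cell m @^-1` [set cell m x]) = 0%E].
have [mZ Z0] : measurable Z /\ mu Z = 0%E.
  by apply: null_bigcup_countable => m; exact: null_cells.
(* A point of the null set [Z] is coded by its keys alone, so the cylinder of
   length [m] around it contains the whole positive set where
   [q = Some (key m x)]; the tag [None] / [Some _] makes the codes injective. *)
pose g i x : nat * seq bool * option (seq bool) :=
  if x \in Z then (0%N, key i.+1 x, None) else
  let: (n, s) := lab x in
  if (i < size s)%N then (n, take i.+1 s, None) else (n, s, Some (key i.+1 x)).
have mg i : label_measurable (g i).
  have -> : g i = (fun p : bool * (nat * seq bool * seq bool) =>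
      if p.1 then (0%N, p.2.2, None) else
      if (i < size p.2.1.2)%N then (p.2.1.1, take i.+1 p.2.1.2, None)
      else (p.2.1.1, p.2.1.2, Some p.2.2)) \o (fun x => (x \in Z, cell i.+1 x)).
    by apply/funext => x; rewrite /g/=; case: ifP => // _; case: (lab x).
  apply: label_measurable_comp; apply: label_measurable_pair => //.
  apply: label_measurableP => -[].
    by rewrite (_ : _ @^-1` _ = Z)//; apply/seteqP; split => x; [exact: set_mem|exact: mem_set].
  rewrite (_ : _ @^-1` _ = ~` Z); first exact: measurableC.
  by apply/seteqP; split => x /= => [/negbT|nZ];
    [rewrite notin_setE|apply/negbTE; rewrite notin_setE].
(* Keys are prefixes of one bit sequence, so agreement of all late keys determines every bit. *)
have key_inj N x y : (forall i, (N <= i)%N -> key i.+1 x = key i.+1 y) -> x = y.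
  move=> kxy; apply: c_inj => i.
  have /(congr1 (nth false ^~ i)) := kxy (maxn N i) (leq_maxl _ _).
  by rewrite !nth_mkseq// ltnS leq_maxr.
have gZ x i : x \in Z -> g i x = (0%N, key i.+1 x, None) by rewrite /g => ->.
have gN x i : x \notin Z -> (size (lab x).2 <= i)%N ->
    g i x = (lab x, Some (key i.+1 x)).
  by move=> /negbTE xZ; rewrite /g xZ; case: (lab x) => n s /=; rewrite ltnNge => ->.
(* Past the length of its word, a point off [Z] shows [Some] of a key, whereas a point of [Z] always
   shows [None]. *)
have g_inj x y : (forall i, g i x = g i y) -> x = y.
  move=> gxy; have [xZ|xZ] := boolP (x \in Z); have [yZ|yZ] := boolP (y \in Z).
  - apply: (key_inj 0%N) => i _; have := gxy i; rewrite !gZ//.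
    by move=> /(congr1 (fun p => p.1.2)).
  - by have := gxy (size (lab y).2); rewrite gZ// gN// => /(congr1 snd).
  - by have := gxy (size (lab x).2); rewrite gN// gZ// => /(congr1 snd).
  - apply: (key_inj (maxn (size (lab x).2) (size (lab y).2))) => i.
    rewrite geq_max => /andP[xi yi]; have := gxy i; rewrite !gN//.
    by move=> /(congr1 (fun p => odflt [::] p.2)).
exists (@code_dist R _ _ _ g), Z; split => //.
  apply: code_dist_compatible => // x m.
  have [xZ|xZ] := boolP (x \in Z); last first.
    (* Off [Z] every cell is positive, and the key of length [m] determines the keys occurring in
       the first [m] codes. *)
    exists (cell m @^-1` [set cell m x] `\` Z).
    split; first by apply: measurableD => //; exact: mcell.
      rewrite measureD_null//; last exact: mcell.
      rewrite measure_gt0; apply/eqP => x0; move/negP: xZ; apply.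
      by rewrite inE; exists m.
    move=> y [[laby keyy] yZ] i im.
    have keyE : key i.+1 y = key i.+1 x.
      have /(congr1 (take i.+1)) := keyy.
      by rewrite /key /mkseq -!map_take take_iota (minn_idPl im).
    rewrite /g (negbTE xZ) laby keyE; case: ifPn => //.
    by rewrite inE.
  (* For [i < m] the word [key m x] is truncated to [key i.+1 x], exactly as in the code of [x]. *)
  exists (q @^-1` [set Some (key m x)] `\` Z).
  split; first by apply: measurableD => //; exact: mq.
    by rewrite measureD_null//; exact: mq.
  move=> y [/= qy yZ] i im.
  rewrite (gZ x)// /g ifF; last by apply/negP; rewrite inE.
  rewrite /lab qy size_mkseq im /key /mkseq -map_take take_iota.
  by rewrite (minn_idPl im).
move=> x y xZ yZ fxy; apply: code_dist_eq1.
have {}xZ : (x \in Z) = false by apply/negP; rewrite inE.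
have {}yZ : (y \in Z) = false by apply/negP; rewrite inE.
rewrite /g xZ yZ /lab.
case qx : (q x) => [s|]; case qy : (q y) => [t|] /=.
- by exfalso; apply: fxy; rewrite (qf x) ?qx// (qf y) ?qy.
- by case: ifP.
- by case: ifP.
- by apply/eqP => -[].
Qed.

End separating_metric.

(** * Recurrence for conservative ergodic maps *)

Section dynamics.
Context (R : realType) (disp : measure_display) (X : measurableType disp).
Context (mu : {sigma_finite_measure set X -> \bar R}) (T : X -> X).
Hypothesis mT : measurable_fun setT T.
Hypothesis nsT : forall A, measurable A -> mu A = 0%E <-> mu (T @^-1` A) = 0%E.

Lemma measurable_iter n : measurable_fun setT (iter n T).
Proof.
elim: n => [|n IHn]; first exact: measurable_id.
exact: (measurableT_comp mT IHn).
Qed.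

Lemma measurable_iter_preimage n A :
  measurable A -> measurable (iter n T @^-1` A).
Proof. by move=> mA; rewrite -[_ @^-1` _]setTI; exact: measurable_iter. Qed.

Lemma null_iter_preimage n A : measurable A -> mu A = 0%E ->
  mu (iter n T @^-1` A) = 0%E.
Proof.
move=> mA A0; elim: n => [//|n IHn].
rewrite (_ : _ @^-1` _ = T @^-1` (iter n T @^-1` A)).
  exact: (nsT (measurable_iter_preimage n mA)).1.
by apply/seteqP; split => x; rewrite /preimage/= -iterSr.
Qed.

Lemma null_orbits Z : measurable Z -> mu Z = 0%E ->
  exists Z', [/\ measurable Z', mu Z' = 0%E &
    forall x, ~ Z' x -> forall n, ~ Z (iter n T x)].
Proof.
move=> mZ Z0; exists (\bigcup_n (iter n T @^-1` Z)).
have [|m0 mu0] := @null_bigcup_countable _ X R mu nat (fun n => iter n T @^-1` Z).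
  by move=> n; split; [exact: measurable_iter_preimage|exact: null_iter_preimage].
by split => // x nZ n Zn; apply: nZ; exists n.
Qed.

Hypothesis consT : conservative mu T.
Hypothesis ergT : ergodic mu T.

(** Conservativity makes almost every point of [B] return infinitely often; ergodicity spreads this
    to almost every point of [X]. *)
Lemma infinitely_often B : measurable B -> (0 < mu B)%E ->
  exists Z, [/\ measurable Z, mu Z = 0%E & forall x, ~ Z x ->
    forall m, exists2 n, (m <= n)%N & B (iter n T x)].
Proof.
move=> mB B0.
pose I := \bigcap_m \bigcup_n (iter (n + m) T @^-1` B).
have mI : measurable I.
  apply: bigcapT_measurable => m; apply: bigcupT_measurable => n.
  exact: measurable_iter_preimage.
(* Ergodicity is stated for exactly invariant sets; having visits at arbitrarily late times is
   unaffected by a shift. *)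
have TI : T @^-1` I = I.
  apply/seteqP; split => x Ix m _.
    have [n _ Bn] := Ix m Logic.I; exists n.+1 => //.
    by change (B (iter (n.+1 + m) T x)); rewrite addSn iterSr.
  have [n _ Bn] := Ix m.+1 Logic.I; exists n => //.
  by change (B (iter (n + m) T (T x))); rewrite -iterSr -addnS.
pose V := B `\` \bigcup_n (iter n.+1 T @^-1` B).
have mV : measurable V.
  apply: measurableD => //; apply: bigcupT_measurable => n.
  exact: measurable_iter_preimage.
(* Points of [V] never return to [B], so [V] is disjoint from its preimages under positive
   iterates. *)
have V0 : mu V = 0%E.
  apply/eqP; rewrite -[_ == _]negbK -measure_gt0; apply/negP => /(consT mV).
  move=> [[//|n] _]; rewrite (_ : _ `&` _ = set0) ?measure0 ?ltxx//.
  by apply/seteqP; split => // x [[Bn _] [_]]; apply; exists n.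
have [Z [mZ Z0 ZP]] := null_orbits mV V0.
have BI : B `\` Z `<=` I.
  (* An orbit starting in [B] with finitely many visits has a last one, and at that time it lies in
     [V]. *)
  move=> x [Bx /ZP nV] m _; apply: contrapT => nB.
  have {nB} nB n : (m <= n)%N -> ~ B (iter n T x).
    by move=> /subnK <- Bn; apply: nB; exists (n - m)%N.
  pose P n := `[< B (iter n T x) >].
  have exP : exists n, P n by exists 0%N; apply/asboolP.
  have ubP n : P n -> (n <= m)%N.
    move=> /asboolP Bn; rewrite leqNgt; apply/negP => /ltnW mn.
    exact: nB mn Bn.
  case: (ex_maxnP exP ubP) => k /asboolP Bk kmax; apply: (nV k); split => //.
  move=> [n _]; rewrite /preimage/= -iterD -iterS -addSn => Bnk.
  have /kmax : P (n.+1 + k)%N by apply/asboolP.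
  by rewrite addSn ltnNge leq_addl.
have I0 : (0 < mu I)%E.
  apply: (@pos_subset _ _ _ mu (B `\` Z)) => //; first exact: measurableD.
  by rewrite measureD_null.
have [I0'|nI0] := ergT mI TI; first by rewrite I0' ltxx in I0.
exists (~` I); split => //; first exact: measurableC.
move=> x /contrapT Ix m; have [n _ Bn] := Ix m Logic.I.
by exists (n + m)%N => //; exact: leq_addl.
Qed.

Lemma negligible_rectangles Z : measurable Z -> mu Z = 0%E ->
  (mu \x mu)%E.-negligible [set p : X * X | Z p.1 \/ Z p.2].
Proof.
move=> mZ Z0; apply: (@negligibleS _ _ _ _ ((Z `*` setT) `|` (setT `*` Z))).
  by move=> p /= [Zp|Zp]; [left|right].
apply: negligibleU; apply/negligibleP; try exact: measurableX.
  by apply: etrans (product_measure1E mu mu mZ measurableT) _; rewrite [X in (X * _)%E]Z0 mul0e.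
by apply: etrans (product_measure1E mu mu measurableT mZ) _; rewrite [X in (_ * X)%E]Z0 mule0.
Qed.

(** * The invariant pseudometric given by the limit superior along orbits *)

Section orbit_limsup.
Context (d : X -> X -> R).
Hypothesis bd : borel_metric d.

Lemma orbit_limsup_shift x y :
  limn_esup (orbit_dist d T (T x) (T y)) = limn_esup (orbit_dist d T x y).
Proof.
rewrite -[RHS]limn_esup_shift; congr limn_esup; apply/funext => n.
by rewrite /orbit_dist -!iterSr.
Qed.

Lemma orbit_limsup_iter n x y :
  limn_esup (orbit_dist d T (iter n T x) (iter n T y)) =
  limn_esup (orbit_dist d T x y).
Proof. by elim: n => [//|n IHn]; rewrite !iterS orbit_limsup_shift. Qed.

Lemma orbit_limsup_triangle x y z (a b : R) :
  (limn_esup (orbit_dist d T x y) <= a%:E)%E ->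
  (limn_esup (orbit_dist d T x z) <= b%:E)%E ->
  (limn_esup (orbit_dist d T y z) <= (a + b)%:E)%E.
Proof.
apply: limn_esup_add => n; rewrite /orbit_dist -EFinD lee_fin.
rewrite (Defs.metric_sym (borel_metric_metric bd) (iter n T x)).
exact: Defs.metric_triangle (borel_metric_metric bd) _ _ _.
Qed.

Lemma measurable_orbit_limsup :
  measurable_fun setT (fun p : X * X => limn_esup (orbit_dist d T p.1 p.2)).
Proof.
apply: (@measurable_fun_limn_esup _ _ R setT
  (fun n (p : X * X) => (d (iter n T p.1) (iter n T p.2))%:E)) => n.
apply: measurableT_comp => //.
apply: (measurableT_comp (borel_metric_measurable bd)
  (g := fun p : X * X => (iter n T p.1, iter n T p.2))).
apply: measurable_fun_pair; apply: measurableT_comp => //; exact: measurable_iter.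
Qed.

(** A common first visit time [n] puts both [n]-th iterates within [delta] of [x0], hence within
    [delta + delta] of each other; invariance carries this back to [x] and [y]. *)
Lemma first_visit_label (x0 : X) (delta : R) :
  (0 < mu [set y | (limn_esup (orbit_dist d T x0 y) <= delta%:E)%E])%E ->
  exists (f : X -> nat) (Z : set X), [/\ label_measurable f, measurable Z,
    mu Z = 0%E & forall x y, ~ Z x -> ~ Z y ->
    ((delta + delta)%:E < limn_esup (orbit_dist d T x y))%E -> f x <> f y].
Proof.
set B := [set y | _] => B0.
have mB : measurable B.
  have := measurable_fun_pair2 x0 measurable_orbit_limsup.
  by move=> /emeasurable_fun_infty_c => /(_ measurableT delta%:E); rewrite setTI.
have [Z [mZ Z0 ZP]] := infinitely_often mB B0.
pose F n := iter n T @^-1` B.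
have mF n : measurable (F n) by exact: measurable_iter_preimage.
(* [seqDU] removes the earlier visits, so [q x] is the time of the first one. *)
have [q mq qE] := @label_of_disjoint _ X nat (seqDU F)
  (seqDU_measurable mF) (fun x k l Fk Fl => trivIset_seqDU F k l Logic.I Logic.I
    (ex_intro _ x (conj Fk Fl))).
(* The default [0] concerns only orbits that miss [B], all of which start in [Z]. *)
exists (odflt 0%N \o q), Z; split => //; first exact: label_measurable_comp.
have qS x : ~ Z x -> exists2 n, q x = Some n & B (iter n T x).
  move=> /ZP/(_ 0%N)[n _ Bn].
  have : (\bigcup_n F n) x by exists n.
  by rewrite seqDU_bigcup_eq => -[k _ Fk]; exists k; [exact/qE|case: Fk].
move=> x y /qS[n qx Bx] /qS[m qy By] xy /=; rewrite qx qy /= => nm.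
move: xy; apply/negP; rewrite -leNgt -(orbit_limsup_iter n).
by apply: orbit_limsup_triangle Bx _; rewrite nm.
Qed.

End orbit_limsup.

(** A Li-Yorke pair has positive limit superior, so it lies in one of countably many gap sets. Were
    all of these null, the whole product would be null, forcing [mu setT = 0]. *)
Lemma li_yorke_uniform_gap d : compatible mu d -> mu setT <> 0%E ->
  {ae (mu \x mu)%E, forall p : X * X, li_yorke_pair d T p.1 p.2} ->
  exists2 delta : R, 0 < delta & ~ (mu \x mu)%E.-negligible
    [set p : X * X | ((delta + delta)%:E < limn_esup (orbit_dist d T p.1 p.2))%E].
Proof.
move=> cd T0 ly; apply: contrapT => nd; apply: T0.
(* Halved so that [r j + r j] is [1/(j+1)]. *)
pose r j : R := j.+1%:R^-1 / 2.
pose F j := [set p : X * X |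
  ((r j + r j)%:E < limn_esup (orbit_dist d T p.1 p.2))%E].
have F0 j : (mu \x mu)%E.-negligible (F j).
  by apply: contrapT => nF; apply: nd; exists (r j); rewrite ?divr_gt0.
have : (mu \x mu)%E.-negligible [set: X * X].
  apply: negligibleS (negligibleU ly (negligible_bigcup F0)) => p _.
  have [[_]|] := pselect (li_yorke_pair d T p.1 p.2); last by left.
  move=> p0; right; have [e e0 ep] : exists2 e : R, 0 < e &
      (e%:E < limn_esup (orbit_dist d T p.1 p.2))%E.
    case: (limn_esup _) p0 => [s| |]// s0.
      by exists (s / 2); move: s0; rewrite ?lte_fin; lra.
    by exists 1; rewrite ?ltry.
  have /cvgr0_norm_lt/(_ e e0)[n _ /(_ n (leqnn n))] := @cvg_harmonic R.
  rewrite ger0_norm ?harmonic_ge0// => ne; exists n => //=; apply: lt_trans ep.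
  by rewrite lte_fin /r -splitr.
rewrite negligibleP// -setXTT => XX0; have := product_measure1E mu mu
  (@measurableT _ X) (@measurableT _ X).
by move=> /(etrans (esym XX0))/esym/eqP; rewrite mule_eq0 orbb => /eqP.
Qed.

End dynamics.

(** * Combination of the first-visit label with the separating metric *)

Theorem proposition2p5 (R : realType) (disp : measure_display)
    (X : measurableType disp) (mu : {sigma_finite_measure set X -> \bar R})
    (T : X -> X)
    (hsys : nonsingular_system mu T)
    (hcons : conservative mu T)
    (herg : ergodic mu T) :
  li_yorke_M_sensitive mu T -> W_measurably_sensitive mu T.
Proof.
case: hsys => sb na T0 mT nsT ly d cd; apply: contrapT => nW.
have [bd _] := cd.
have [delta delta0 gap] := li_yorke_uniform_gap cd T0 (ly d cd).
(* If every such ball were null, [delta] itself would witness W-measurable sensitivity for [d]. *)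
have [x0 x0P] : exists x0, (0 < mu [set y |
    (limn_esup (orbit_dist d T x0 y) <= delta%:E)%E])%E.
  apply: contrapT => nx; apply: nW; exists delta => // x.
  have mB : measurable [set y | (limn_esup (orbit_dist d T x y) <= delta%:E)%E].
    have := measurable_fun_pair2 x (measurable_orbit_limsup mT bd).
    by move=> /emeasurable_fun_infty_c => /(_ measurableT delta%:E); rewrite setTI.
  apply: (@negligibleS _ _ _ _ _ _ _ (iffRL (negligibleP mu mB) _)).
    by move=> y /= /negP; rewrite -leNgt.
  apply/eqP; rewrite -[_ == _]negbK -measure_gt0; apply/negP => x_pos.
  by apply: nx; exists x.
have [f [Z1 [mf mZ1 Z10 Z1P]]] := first_visit_label mT nsT hcons herg bd x0P.
have [d' [Z2 [cd' mZ2 Z20 Z2P]]] := exists_separating_metric sb na T0 mf.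
(* Off [Z] the whole orbit avoids both exceptional sets. *)
have [Z [mZ Z0 ZP]] : exists Z, [/\ measurable Z, mu Z = 0%E &
    forall x, ~ Z x -> forall n, ~ (Z1 `|` Z2) (iter n T x)].
  apply: null_orbits => //; first exact: measurableU.
  apply: measure_negligible; first exact: measurableU.
  by apply: negligibleU; apply/negligibleP.
(* A gap pair with both points off [Z] keeps different labels along its orbits, so its
   [d']-distances are all [1] and it is not Li-Yorke for [d']. *)
apply: gap; apply: negligibleS
  (negligibleU (ly d' cd') (negligible_rectangles mZ Z0)) => -[x y] /= xy.
have [Zxy|nZ] := pselect (Z x \/ Z y); [by right|left => /= -[+ _]].
apply/eqP; rewrite gt_eqF// (@lt_le_trans _ _ 1%E)//.
apply: le_limn_einf => n; rewrite lee_fin Z2P//.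
- by move=> Z2x; apply: (ZP x _ n); [move=> ?; apply: nZ; left|right].
- by move=> Z2y; apply: (ZP y _ n); [move=> ?; apply: nZ; right|right].
apply: Z1P.
- by move=> Z1x; apply: (ZP x _ n); [move=> ?; apply: nZ; left|left].
- by move=> Z1y; apply: (ZP y _ n); [move=> ?; apply: nZ; right|left].
by rewrite orbit_limsup_iter.
Qed.
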